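(* Let $A, B$ be rearrangement-invariant quasi-Banach function spaces over a resonant measure space $(\mathcal{R}, \mu)$, and let $\lVert \cdot \rVert_{\overline{A}}$, $\lVert \cdot \rVert_{\overline{B}}$ be the canonical representation quasinorms (over $([0,\infty),\lambda)$) of $\lVert\cdot\rVert_A$, $\lVert\cdot\rVert_B$. Then for every $f \in \mathcal{M}(\mathcal{R}, \mu)$ $$\lVert f \rVert_{A \cap B} = \lVert f^* \rVert_{\overline{A} \cap \overline{B}}.$$ Furthermore, $\lVert \cdot \rVert_{\overline{A} \cap \overline{B}}$ coincides with the canonical representation quasinorm of $\lVert \cdot \rVert_{A \cap B}$, i.e. $\lVert g\rVert_{\overline{A}\cap\overline{B}}=\lVert g\rVert_{\overline{A\cap B}}$ for every $g\in\mathcal{M}([0,\infty),\lambda)$.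
   Context: A measure space is resonant if it is $\sigma$-finite and either non-atomic or completely atomic with all atoms of the same measure $\beta\in(0,\infty)$. $\lambda$ is Lebesgue measure on $[0,\infty)$. $\mathcal{M}(\mathcal{R},\mu)$ is the set of ($\mu$-a.e. equivalence classes of) measurable functions on $\mathcal{R}$ (infinite values are allowed), and $\mathcal{M}_+$ its cone of non-negative functions. The non-increasing rearrangement of $f$ is $f^*(t)=\inf\{s\ge 0:\ \mu(\{|f|>s\})\le t\}$, $t\in[0,\infty)$. An r.i. quasi-Banach function norm is a functional $\lVert\cdot\rVert:\mathcal{M}(\mathcal{R},\mu)\to[0,\infty]$ with $\lVert\,|f|\,\rVert=\lVert f\rVert$ such that: (quasinorm) $\lVert af\rVert=|a|\lVert f\rVert$ for $a\in\mathbb{C}$, $f\in\mathcal{M}_+$, $\lVert f\rVert=0\Leftrightarrow f=0$ a.e., and there is $K\ge1$ with $\lVert f+g\rVert\le K(\lVert f\rVert+\lVert g\rVert)$ for all $f,g\in\mathcal{M}_+$; (lattice property) $0\le f\le g$ a.e. implies $\lVert f\rVert\le\lVert g\rVert$; (Fatou property) $0\le f_n\uparrow f$ a.e. implies $\lVert f_n\rVert\uparrow\lVert f\rVert$; $\lVert\chi_E\rVert<\infty$ whenever $\mu(E)<\infty$; (rearrangement-invariance) $\lVert f\rVert=\lVert g\rVert$ whenever $f^*=g^*$. The corresponding r.i. quasi-Banach function space is $X=\{f\in\mathcal{M}(\mathcal{R},\mu):\lVert f\rVert_X<\infty\}$. Intersection: $A\cap B$ is equipped with $\lVert\cdot\rVert_{A\cap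 B}=\max\{\lVert\cdot\rVert_A,\lVert\cdot\rVert_B\}$; it is an r.i. quasi-Banach function space. Canonical representation quasinorm of $X$: for $g\in\mathcal{M}([0,\infty),\lambda)$ put $\lVert g\rVert_{\overline{X}}=\lVert \widetilde g\rVert_X$, where $\widetilde g\in\mathcal{M}(\mathcal{R},\mu)$ is: if $(\mathcal{R},\mu)$ is non-atomic, $\widetilde g=(g^*\chi_{[0,\mu(\mathcal{R}))})\circ\sigma$ with $\sigma:\mathcal{R}\to[0,\mu(\mathcal{R}))$ a fixed measure-preserving map; if $(\mathcal{R},\mu)$ is completely atomic with atoms $e_n$ ($n=0,1,2,\dots$, $(n+1)\beta\le\mu(\mathcal{R})$) of measure $\beta$, $\widetilde g(e_n)=\frac1\beta\int_{n\beta}^{(n+1)\beta}g^*\,d\lambda$. This does not depend on the choice of $\sigma$ or the enumeration, it is an r.i. quasi-Banach function norm over $([0,\infty),\lambda)$, and $\lVert f\rVert_X=\lVert f^*\rVert_{\overline{X}}$ for all $f\in\mathcal{M}(\mathcal{R},\mu)$. $\overline{X}$ denotes the corresponding space. *)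

(* Defs.v *)
From mathcomp Require Import all_boot all_order all_algebra.
From mathcomp Require Import all_classical all_reals all_analysis.
From mathcomp Require Import measurable_realfun complex.
Set Implicit Arguments.
Unset Strict Implicit.
Unset Printing Implicit Defensive.
Import Order.TTheory GRing.Theory Num.Theory.
Import numFieldNormedType.Exports.
Local Open Scope classical_set_scope.
Local Open Scope ring_scope.
Local Open Scope ereal_scope.

(** Extended complex values: [None] is the infinite value. *)

Definition ecomplex (R : realType) := option R[i].

Section ecomplex.
Context {R : realType}.

Definition ecabs (z : ecomplex R) : \bar R :=
  if z is Some w then (Normc.normc w)%:E else +oo.

(* Only meant for values in [0, +oo]. *)
Definition ec_of_ereal (r : \bar R) : ecomplex R :=
  if r is r'%:E then Some (r'%:C)%C else None.

(* With the convention 0 * oo = 0, as in [\bar R]. *)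
Definition ecscale (a : R[i]) (z : ecomplex R) : ecomplex R :=
  match z with
  | Some w => Some (a * w)%R
  | None => if a == 0%R then Some 0%R else None
  end.

Definition ecRe (z : ecomplex R) : R := if z is Some w then complex.Re w else 0%R.
Definition ecIm (z : ecomplex R) : R := if z is Some w then complex.Im w else 0%R.

End ecomplex.

(** M(T) consists of the measurable extended complex functions, with cone M_+(T).
    Elements of M_+(T) are written as [0, +oo]-valued functions [f : T -> \bar R]
    and enter M(T) through [ec_of_ereal]. Almost everywhere equal functions are
    not identified: they have the same rearrangement, so that the
    rearrangement-invariance axiom [riqb_rearr] makes norms well defined on
    equivalence classes. *)

Section measurable_functions.
Context d (T : measurableType d) (R : realType).

Definition ecmeasurable (f : T -> ecomplex R) : Prop :=
  [/\ measurable [set x | f x = None],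
      measurable_fun setT (fun x => ecRe (f x)) &
      measurable_fun setT (fun x => ecIm (f x))].

Definition Mplus (f : T -> \bar R) : Prop :=
  measurable_fun setT f /\ (forall x, 0 <= f x).

End measurable_functions.

Definition toM (T : Type) (R : realType) (f : T -> \bar R) : T -> ecomplex R :=
  fun x => ec_of_ereal (f x).

Section resonant.
Context d (T : measurableType d) (R : realType) (mu : {measure set T -> \bar R}).

Definition atom (A : set T) : Prop :=
  [/\ measurable A, 0 < mu A &
      forall B, measurable B -> B `<=` A -> mu B = 0 \/ mu B = mu A].

Definition non_atomic : Prop := forall A, ~ atom A.

Definition completely_atomic : Prop :=
  forall A, measurable A -> 0 < mu A -> exists2 B, atom B & B `<=` A.

Definition resonant : Prop :=
  sigma_finite setT mu /\
  (non_atomic \/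
   completely_atomic /\
   exists2 beta : R, (0 < beta)%R & forall A, atom A -> mu A = beta%:E).

End resonant.

(** Non-increasing rearrangement; only its values at t >= 0 are meaningful. *)

Definition rearr d (T : measurableType d) (R : realType)
    (mu : {measure set T -> \bar R}) (f : T -> ecomplex R) (t : R) : \bar R :=
  ereal_inf [set s%:E | s in [set s : R | (0 <= s)%R /\
                                mu [set x | s%:E < ecabs (f x)] <= t%:E]].

(** ([0, oo), lambda) is realised as the real line with Lebesgue measure
    restricted to [0, oo), so that the negative half-line is a null set. *)

Definition lambda0 (R : realType) :
    {measure set (measurableTypeR R) -> \bar R} :=
  mrestr (@lebesgue_measure R) (measurable_itv `[0%R, +oo[).

Record ri_quasi_Banach_norm d (T : measurableType d) (R : realType)
    (mu : {measure set T -> \bar R})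
    (N : (T -> ecomplex R) -> \bar R) : Prop := {
  riqb_ge0 : forall f, ecmeasurable f -> 0 <= N f;
  riqb_abs : forall f, ecmeasurable f -> N (toM (fun x => ecabs (f x))) = N f;
  riqb_scale : forall (a : R[i]) (f : T -> \bar R), Mplus f ->
    N (fun x => ecscale a (toM f x)) = (Normc.normc a)%:E * N (toM f);
  riqb_eq0 : forall f : T -> \bar R, Mplus f ->
    N (toM f) = 0 <-> {ae mu, forall x, f x = 0};
  riqb_quasi_triangle : exists2 K : R, (1 <= K)%R &
    forall f g : T -> \bar R, Mplus f -> Mplus g ->
      N (toM (f \+ g)) <= K%:E * (N (toM f) + N (toM g));
  riqb_lattice : forall f g : T -> \bar R, Mplus f -> Mplus g ->
    {ae mu, forall x, f x <= g x} -> N (toM f) <= N (toM g);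
  riqb_Fatou : forall (f_ : nat -> T -> \bar R) (f : T -> \bar R),
    (forall n, Mplus (f_ n)) -> Mplus f ->
    {ae mu, forall x, nondecreasing_seq (f_ ^~ x) /\
                      f_ n x @[n --> \oo] --> f x} ->
    nondecreasing_seq (fun n => N (toM (f_ n))) /\
    N (toM (f_ n)) @[n --> \oo] --> N (toM f);
  riqb_indic : forall E, measurable E -> mu E < +oo ->
    N (toM (EFin \o \1_E)) < +oo;
  riqb_rearr : forall f g, ecmeasurable f -> ecmeasurable g ->
    (forall t, (0 <= t)%R -> rearr mu f t = rearr mu g t) -> N f = N g
}.

(** Finite exactly on the intersection of the spaces {NA < oo} and {NB < oo}. *)

Definition capnorm (T : Type) (R : realType)
    (NA NB : (T -> ecomplex R) -> \bar R) (f : T -> ecomplex R) : \bar R :=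
  maxe (NA f) (NB f).

Section canonical_representation.
Context d (T : measurableType d) (R : realType) (mu : {measure set T -> \bar R}).

Definition supp_itv : set R := [set t | (0 <= t)%R /\ t%:E < mu setT].

Definition measure_preserving_onto_itv (sigma : T -> R) : Prop :=
  [/\ measurable_fun setT sigma,
      forall x, supp_itv (sigma x) &
      forall E : set R, measurable E -> E `<=` supp_itv ->
        mu (sigma @^-1` E) = lebesgue_measure E].

Definition atom_index (beta : R) : set nat :=
  [set n | (n.+1%:R * beta)%:E <= mu setT].

(* Atoms are measurable sets, so they exhaust T only up to a null set. *)
Definition atom_enumeration (beta : R) (e : nat -> set T) : Prop :=
  [/\ forall n, atom_index beta n -> atom mu (e n) /\ mu (e n) = beta%:E,
      trivIset (atom_index beta) e &
      mu (~` \bigcup_(n in atom_index beta) e n) = 0].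

(* The choices (sigma, resp. the numbering of the atoms) on which the
   construction of g |-> g~ relies. *)
Inductive representation_choice : Type :=
| NonAtomicChoice (sigma : T -> R) of
    non_atomic mu & measure_preserving_onto_itv sigma
| AtomicChoice (beta : R) (e : nat -> set T) of
    completely_atomic mu & (0 < beta)%R & atom_enumeration beta e.

(* In the atomic case the (disjoint) sum is the function with value
   1/beta * \int_(n beta)^((n+1) beta) g^* on the atom e n. *)
Definition transplant (D : representation_choice)
    (g : measurableTypeR R -> ecomplex R) : T -> \bar R :=
  match D with
  | NonAtomicChoice sigma _ _ =>
      ((rearr (lambda0 R) g) \_ supp_itv) \o sigma
  | AtomicChoice beta e _ _ _ => fun x =>
      \sum_(0 <= n <oo | n \in atom_index beta)
        ((beta^-1)%:E *
           \int[lebesgue_measure]_(t in `[(n%:R * beta)%R, (n.+1%:R * beta)%R[)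
             rearr (lambda0 R) g t) * (\1_(e n) x)%:E
  end.

Definition canonical_norm (D : representation_choice)
    (N : (T -> ecomplex R) -> \bar R)
    (g : measurableTypeR R -> ecomplex R) : \bar R :=
  N (toM (transplant D g)).

End canonical_representation.

(* Main.v *)
Require Import Defs.
From mathcomp Require Import all_boot all_order all_algebra.
From mathcomp Require Import all_classical all_reals all_analysis.
From mathcomp Require Import measurable_realfun complex.
Set Implicit Arguments.
Unset Strict Implicit.
Unset Printing Implicit Defensive.
Import Order.TTheory GRing.Theory Num.Theory.
Import numFieldNormedType.Exports.
Local Open Scope classical_set_scope.
Local Open Scope ring_scope.
Local Open Scope ereal_scope.

(** Both claims follow from rearrangement invariance once the transplant of
    [g] is known to have a distribution function depending only on [g^*], and
    the transplant of [f^*] to be equimeasurable with [|f|]. In the non-atomic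
    case a measure-preserving map reduces this to the interval [supp_itv mu]. In
    the atomic case every measurable set has measure [+oo] or a multiple of
    [beta], so [f^*] is constant on each interval [n beta, (n+1) beta) and the
    averages defining the transplant are the values [f^*(n beta)]. All
    representation choices of a resonant space are of the same kind, with the
    same [beta], unless the space is null. *)

(** * Measurability of extended complex functions; level sets of the rearrangement *)

Section rearrangement.
Context {R : realType}.

Lemma ecabs_of_ereal (r : \bar R) : 0 <= r -> ecabs (ec_of_ereal r) = r.
Proof.
case: r => [r| |] //=; rewrite lee_fin => r0.
by rewrite expr0n addr0 sqrtr_sqr ger0_norm.
Qed.

Context d (T : measurableType d).

Lemma ecmeasurable_toM (h : T -> \bar R) :
  measurable_fun setT h -> ecmeasurable (toM h).
Proof.
move=> mh; split.
(* [ec_of_ereal] sends both infinite values to [None]. *)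
- rewrite (_ : [set _ | _] = h @^-1` [set -oo; +oo]); last first.
    apply/seteqP; split => x; rewrite /toM /=; case: (h x) => //=;
      by [left|right|move=> ? []].
  by rewrite -[X in measurable X]setTI; apply: mh => //; apply: measurableU.
- rewrite (_ : (fun _ => _) = fine \o h).
    by apply: measurableT_comp => //; exact: fine_measurable.
  by apply/funext => x; rewrite /toM /=; case: (h x).
- rewrite (_ : (fun _ => _) = cst 0%R) //.
  by apply/funext => x; rewrite /toM /=; case: (h x).
Qed.

Lemma measurable_ecabs (f : T -> ecomplex R) :
  ecmeasurable f -> measurable_fun setT (ecabs \o f).
Proof.
move=> [mN mre mim].
pose b x := `[< f x = None >].
rewrite (_ : _ \o _ = fun x => if b x then +oo else
    (Num.sqrt ((ecRe (f x)) ^+ 2 + (ecIm (f x)) ^+ 2))%:E); last first.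
  apply/funext => x /=; rewrite /b; case: asboolP => [->//|].
  by case: (f x) => [[u v]|].
apply: measurable_fun_ifT => //.
- apply: (@measurable_fun_bool _ _ _ _ true).
  by rewrite setTI (_ : _ @^-1` _ = [set x | f x = None]) //;
    apply/seteqP; split => x /asboolP.
- apply/measurable_EFinP; apply: measurableT_comp.
    by apply: continuous_measurable_fun; exact: sqrt_continuous.
  by apply: measurable_funD; apply: measurable_funX.
Qed.

Lemma measurable_gt_ecabs (f : T -> ecomplex R) (s : \bar R) :
  ecmeasurable f -> measurable [set x | s < ecabs (f x)].
Proof.
move=> /measurable_ecabs mf; rewrite -[X in measurable X]setTI.
exact: emeasurable_fun_o_infty.
Qed.

Context (mu : {measure set T -> \bar R}).
Implicit Types (f : T -> ecomplex R) (s t : R).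

Lemma rearr_ge0 f t : 0 <= rearr mu f t.
Proof. by apply: le_ereal_inf_tmp => _ [s [s0 _] <-]; rewrite lee_fin. Qed.

Lemma rearr_nonincreasing f : {homo rearr mu f : t t' / (t <= t')%R >-> t' <= t}.
Proof.
move=> t t' tt'; apply: le_ereal_inf => _ [s [s0 st] <-]; exists s => //.
by split=> //; apply: le_trans st _; rewrite lee_fin.
Qed.

(* Right continuity of the distribution function, i.e. continuity of [mu] from
   below, gives the implication from right to left. *)
Lemma lt_rearr f s t : ecmeasurable f -> (0 <= s)%R ->
  (s%:E < rearr mu f t) = (t%:E < mu [set x | s%:E < ecabs (f x)]).
Proof.
move=> mf s0; apply/idP/idP; apply: contraTT; rewrite -!leNgt => h.
  by apply: ereal_inf_lbound; exists s.
pose F n := [set x | (s + n.+1%:R^-1)%:E < ecabs (f x)].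
have mF n : measurable (F n) by exact: measurable_gt_ecabs.
have FE : [set x | s%:E < ecabs (f x)] = \bigcup_n F n.
  apply/seteqP; split => x /=; last first.
    by move=> [n _]; apply: le_lt_trans; rewrite lee_fin lerDl.
  move=> sf; have [r sr rf] : exists2 r, (s < r)%R & r%:E <= ecabs (f x).
    case: (ecabs (f x)) sf => [r|_|//]; last first.
      by exists (s + 1)%R; rewrite ?ltrDl ?leey.
    by rewrite lte_fin => sr; exists r.
  have [n _ /(_ _ (leqnn n)) nr] : \forall n \near \oo, (n.+1%:R^-1 < r - s)%R.
    by apply: near_infty_natSinv_lt (PosNum _); rewrite subr_gt0.
  by exists n => //; apply: lt_le_trans rf; rewrite lte_fin -ltrBrDl.
have ndF : nondecreasing_seq F.
  move=> n m nm; apply/subsetPset => x; apply: le_lt_trans.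
  by rewrite lee_fin lerD2l lef_pV2 ?posrE ?ltr0n ?ler_nat.
have mUF : measurable (\bigcup_n F n) by apply: bigcup_measurable.
rewrite FE; have /cvg_lim <- // := nondecreasing_cvg_mu (mu := mu) mF mUF ndF.
apply: lime_le.
  by apply/cvg_ex; eexists; exact: (nondecreasing_cvg_mu (mu := mu) mF mUF ndF).
apply: nearW => n /=.
(* The infimum is at most [s], so some admissible level [r] lies below [s + 1/(n+1)], and [F n] is
   contained in the level set of [r]. *)
have /ereal_inf_lt[_ [r [r0 rt] <-] rs] : rearr mu f t < (s + n.+1%:R^-1)%:E.
  by apply: le_lt_trans h _; rewrite lte_fin ltrDl.
apply: le_trans rt; apply: le_measure; rewrite ?inE //.
  exact: measurable_gt_ecabs.
by move=> x; apply: lt_trans.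
Qed.

(** Superlevel sets of a monotone function are intervals. *)
Lemma measurable_rearr f :
  measurable_fun (setT : set (measurableTypeR R)) (rearr mu f).
Proof.
apply: (measurability _ (ErealGenOInfty.measurableE R)).
move=> /= _ [_ [a ->]] <-; rewrite setTI preimage_itvoy.
apply: is_interval_measurable => t t' _ /= at' r /andP[_ rt'].
by apply: lt_le_trans at' _; exact: rearr_nonincreasing.
Qed.

End rearrangement.

(** The spaces may differ, so that a function on [T] can be compared with its rearrangement on the
    half-line. *)
Lemma eq_rearr (R : realType) d (T : measurableType d)
    (mu : {measure set T -> \bar R})
    d' (T' : measurableType d') (mu' : {measure set T' -> \bar R})
    (f : T -> ecomplex R) (f' : T' -> ecomplex R) (t : R) :
  (forall s : R, (0 <= s)%R ->
     mu [set x | s%:E < ecabs (f x)] = mu' [set x | s%:E < ecabs (f' x)]) ->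
  rearr mu f t = rearr mu' f' t.
Proof.
move=> ff'; congr (ereal_inf (image _ _)); apply/funext => s; apply/propext.
by split => -[s0]; [rewrite ff'|rewrite -ff'] => //; split.
Qed.

(** By [lt_rearr], the superlevel sets of a rearrangement on the half-line have this form, with [D]
    a value of the distribution function. *)
Lemma lebesgue_measure_ge0_lt (R : realType) (D : \bar R) : 0 <= D ->
  lebesgue_measure [set t : R | (0 <= t)%R /\ t%:E < D] = D.
Proof.
case: D => [r r0|_|//].
  rewrite (_ : [set _ | _] = [set` `[0%R, r[]); last first.
    by apply/seteqP; split => x /=; rewrite in_itv /= lte_fin => /andP.
  rewrite lebesgue_measure_itv /= lte_fin sube0.
  case: ltP => // r0'; apply/eqP; rewrite eqe eq_le r0' andbT.
  by rewrite -lee_fin.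
rewrite (_ : [set _ | _] = [set` `[0%R, +oo[]).
  by rewrite lebesgue_measure_itv /= ltry sube0.
by apply/seteqP; split => x /=; rewrite in_itv /= andbT ?ltry //; case.
Qed.

Lemma rearr_rearr (R : realType) d (T : measurableType d)
    (mu : {measure set T -> \bar R}) (f : T -> ecomplex R) : ecmeasurable f ->
  rearr (lambda0 R) (toM (rearr mu f)) = rearr mu f.
Proof.
move=> mf; apply/funext => t; apply: eq_rearr => s s0.
rewrite /lambda0 /= /mrestr -[RHS]lebesgue_measure_ge0_lt //.
congr (lebesgue_measure _); apply/seteqP; split => x /=;
  rewrite in_itv /= andbT /toM ecabs_of_ereal ?rearr_ge0 // lt_rearr //; tauto.
Qed.

(** Serves to add up the masses of disjoint atoms of common mass [beta]. *)
Lemma nneseries_counting (R : realType) (beta : R) (D : set nat) :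
  (0 <= beta)%R ->
  \sum_(0 <= n <oo | n \in D) beta%:E = beta%:E * counting D.
Proof.
move=> b0.
have -> : counting D = \sum_(0 <= n <oo | n \in D) (1 : \bar R).
  have DE : \bigcup_(n in D) [set n] = D by rewrite bigcup_imset1 image_id.
  rewrite -[in LHS]DE (measure_bigcup (counting : {measure set nat -> \bar R})) //.
  - by apply: eq_eseriesr => n _; rewrite /= /counting asboolT ?fset_set1 ?finmap.cardfs1.
  - by move=> m n _ _ [x [-> ->]].
by rewrite -nneseriesZl // mule1.
Qed.

(** * Distribution functions of transplants *)

Section transplant.
Context {R : realType} d (T : measurableType d) (mu : {measure set T -> \bar R}).
Implicit Types (g : measurableTypeR R -> ecomplex R) (s : R).

Lemma measurable_supp_itv : measurable (supp_itv mu : set (measurableTypeR R)).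
Proof.
apply: is_interval_measurable => t t' [t0 _] [_ t'mu] r /andP[tr rt']; split.
  exact: le_trans tr.
exact: le_lt_trans t'mu.
Qed.

(** The value that [transplant] takes on the atom [e n]. *)
Definition average_rearr (beta : R) g (n : nat) : \bar R :=
  (beta^-1)%:E *
     \int[lebesgue_measure]_(t in `[(n%:R * beta)%R, (n.+1%:R * beta)%R[)
       rearr (lambda0 R) g t.

Lemma average_rearr_ge0 (beta : R) g n : (0 < beta)%R -> 0 <= average_rearr beta g n.
Proof.
move=> b0; apply: mule_ge0; first by rewrite lee_fin invr_ge0 ltW.
by apply: integral_ge0 => t _; exact: rearr_ge0.
Qed.

Lemma transplant_ge0 (D : representation_choice mu) g x : 0 <= transplant D g x.
Proof.
case: D => [sigma nA sP|beta e cA b0 eP] /=.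
  by rewrite patchE; case: ifPn => // _; exact: rearr_ge0.
apply: nneseries_ge0 => n _ _; apply: mule_ge0; last by rewrite lee_fin.
exact: average_rearr_ge0.
Qed.

Lemma measurable_transplant (D : representation_choice mu) g :
  measurable_fun setT (transplant D g).
Proof.
case: D => [sigma nA [ms _ _]|beta e cA b0 [eP _ _]] /=.
  apply: measurableT_comp => //.
  apply/(measurable_restrictT _ measurable_supp_itv).
  by apply: measurable_funTS; exact: measurable_rearr.
apply: ge0_emeasurable_sum.
  move=> k x _ _; apply: mule_ge0; last by rewrite lee_fin.
  exact: average_rearr_ge0.
move=> k /set_mem/eP[[me _ _] _].
apply: emeasurable_funM; first exact: measurable_cst.
by apply/measurable_EFinP; exact: measurable_indic.
Qed.

(** The superlevel set is the preimage under [sigma] of a measurable subset of [supp_itv mu]; the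
    resulting formula no longer involves [sigma]. *)
Lemma distribution_transplant_nonatomic sigma nA sP g s : (0 <= s)%R ->
  mu [set x | s%:E < transplant (@NonAtomicChoice _ _ _ mu sigma nA sP) g x] =
  lebesgue_measure (supp_itv mu `&` [set t | s%:E < rearr (lambda0 R) g t]).
Proof.
move=> s0; have [ms sI pP] := sP; rewrite -pP.
- congr (mu _); apply/seteqP; split => x /=; rewrite patchE mem_set // => -[].
  by [].
- apply: measurableI; first exact: measurable_supp_itv.
  rewrite -[X in measurable X]setTI.
  by apply: emeasurable_fun_o_infty => //; exact: measurable_rearr.
- by move=> t [].
Qed.

Lemma transplant_atom beta e cA b0 eP g n x : atom_index mu beta n -> e n x ->
  transplant (@AtomicChoice _ _ _ mu beta e cA b0 eP) g x = average_rearr beta g n.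
Proof.
move=> In enx /=; have [_ tI _] := eP.
(* Split off the [n]-th term; disjointness of the atoms makes all others vanish at [x]. *)
rewrite (nneseriesD1 (n := n)) /=; first last.
- exact/mem_set.
- move=> k _; apply: mule_ge0; last by rewrite lee_fin.
  exact: average_rearr_ge0.
rewrite indicE mem_set // mule1 eseries0 ?adde0 // => k _ /andP[/set_mem Ik /eqP kn].
rewrite indicE memNset ?mule0 // => ekx; apply: kn; apply: tI => //.
by exists x.
Qed.

Lemma transplant_notin_atoms beta e cA b0 eP g x :
  (forall n, atom_index mu beta n -> ~ e n x) ->
  transplant (@AtomicChoice _ _ _ mu beta e cA b0 eP) g x = 0.
Proof.
move=> ne /=; rewrite eseries0 // => k _ /set_mem Ik.
by rewrite indicE memNset ?mule0 //; exact: ne.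
Qed.

(** The superlevel set is the disjoint union of the atoms whose average exceeds [s]; off the atoms
    the transplant is 0, which does not exceed [s >= 0]. *)
Lemma distribution_transplant_atomic beta e cA b0 eP g s : (0 <= s)%R ->
  mu [set x | s%:E < transplant (@AtomicChoice _ _ _ mu beta e cA b0 eP) g x] =
  beta%:E * counting (atom_index mu beta `&` [set n | s%:E < average_rearr beta g n]).
Proof.
move=> s0; have [eb tI _] := eP.
rewrite -nneseries_counting; last exact: ltW.
pose I := atom_index mu beta `&` [set n | s%:E < average_rearr beta g n].
rewrite (_ : [set x | _] = \bigcup_(n in I) e n).
  rewrite measure_bigcup.
  - by apply: eq_eseriesr => n /set_mem[/eb[]].
  - by move=> n [/eb[[]]].
  - by apply: sub_trivIset tI => n [].
apply/seteqP; split => x; last first.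
  by move=> [n [In sn] enx]; rewrite /mkset (transplant_atom cA b0 eP g In enx).
rewrite /mkset => sx.
have [[n [In enx]]|nI] := pselect (exists n, atom_index mu beta n /\ e n x).
  by exists n => //; split => //; move: sx; rewrite (transplant_atom cA b0 eP g In enx).
move: sx; rewrite transplant_notin_atoms ?lte_fin ?ltNge ?s0 // => n In enx.
by apply: nI; exists n.
Qed.

Lemma measure_gt_transplant_null (D : representation_choice mu) g s :
  mu setT = 0 -> mu [set x | s%:E < transplant D g x] = 0.
Proof.
move=> mu0; apply: (subset_measure0 (B := setT)) => //.
rewrite -[X in measurable X]setTI.
by apply: emeasurable_fun_o_infty => //; exact: measurable_transplant.
Qed.

Lemma atom_enumeration_atom (beta : R) e : (0 < beta)%R ->
  atom_enumeration mu beta e -> mu setT = 0 \/ exists2 A, atom mu A & mu A = beta%:E.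
Proof.
move=> b0 [eb _ muN].
have [/eb[]|I0] := pselect (atom_index mu beta 0%N); first by right; exists (e 0%N).
(* If 0 is not an index, no [n] is, since [beta <= (n+1) beta]; the union of the atoms is then empty
   and its null complement is the whole space. *)
left; rewrite -muN bigcup0 ?setC0 // => n; rewrite /atom_index /= => nI.
exfalso; apply: I0; apply: le_trans nI.
by rewrite lee_fin ler_pM2r // ler_nat.
Qed.

(** On a null space nothing determines [beta]. Elsewhere an atomic choice provides an atom of mass
    [beta], which rules out non-atomicity and, by resonance, fixes [beta]. *)
Lemma eq_distribution_transplant (D1 D2 : representation_choice mu) g s :
  resonant mu -> (0 <= s)%R ->
  mu [set x | s%:E < transplant D1 g x] = mu [set x | s%:E < transplant D2 g x].
Proof.
move=> [_ res] s0; have [mu0|muN0] := eqVneq (mu setT) 0.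
  by rewrite !measure_gt_transplant_null.
have atomP (beta : R) e : (0 < beta)%R -> atom_enumeration mu beta e ->
    exists2 A, atom mu A & mu A = beta%:E.
  by move=> b0 /(atom_enumeration_atom b0)[/eqP|//]; rewrite (negPf muN0).
case: D1 D2 => [sigma nA sP|beta e cA b0 eP] [sigma' nA' sP'|beta' e' cA' b0' eP'].
- by rewrite !distribution_transplant_nonatomic.
- by have [A /nA] := atomP _ _ b0' eP'.
- by have [A /nA'] := atomP _ _ b0 eP.
have [A aA muA] := atomP _ _ b0 eP; have [A' aA' muA'] := atomP _ _ b0' eP'.
case: res => [/(_ A)//|[_ [beta0 _ atomE]]].
have bb' : beta = beta' by apply/EFin_inj; rewrite -muA -muA' !atomE.
by rewrite !distribution_transplant_atomic // bb'.
Qed.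

(** Up to a null set, [S] is the disjoint union of its traces on the atoms, each of mass 0 or
    [beta]. *)
Lemma measure_atomic_multiple (beta : R) e S : (0 < beta)%R ->
  atom_enumeration mu beta e -> measurable S ->
  mu S = +oo \/ exists k : nat, mu S = (k%:R * beta)%:E.
Proof.
move=> b0 [eb tI muN] mS; set I := atom_index mu beta in eb tI muN.
have mU : measurable (\bigcup_(n in I) e n).
  by apply: bigcup_measurable => n /eb[[]].
pose J := [set n | mu (e n `&` S) != 0].
suff -> : mu S = beta%:E * counting (J `&` I).
  rewrite /counting; case: asboolP => _; last by left; rewrite gt0_muley ?lte_fin.
  by right; eexists; rewrite -EFinM mulrC.
rewrite -nneseries_counting; last exact: ltW.
have -> : mu S = mu (\bigcup_(n in I) (e n `&` S)).
  rewrite -setI_bigcupl setIC (measureDI mu mS mU) -[RHS]add0e; congr (_ + _).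
  by apply: (subset_measure0 (measurableD mS mU) (measurableC mU)) => //.
rewrite measure_bigcup; first last.
- exact: trivIset_setIr.
- by move=> n /eb[[me _ _] _]; exact: measurableI.
transitivity (\sum_(0 <= n <oo | n \in I) if n \in J then beta%:E else 0).
  apply: eq_eseriesr => n /set_mem/eb[[me _ ae] men].
  case: ifPn => [|/negP nJ].
    rewrite inE /J /=.
    by have [->|->] := ae _ (measurableI _ _ me mS) (@subIsetl _ _ _);
      rewrite ?eqxx ?men.
  by apply/eqP; apply: contrapT => /negP nz; apply: nJ; apply/mem_set.
rewrite -eseries_mkcondl; apply: eq_eseriesl => n.
by rewrite in_setI.
Qed.

Lemma average_rearr_rearr (beta : R) e f n : (0 < beta)%R ->
  atom_enumeration mu beta e -> ecmeasurable f ->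
  average_rearr beta (toM (rearr mu f)) n = rearr mu f (n%:R * beta).
Proof.
move=> b0 eP mf; rewrite /average_rearr rearr_rearr //.
rewrite (eq_integral (cst (rearr mu f (n%:R * beta)))); last first.
  move=> t; rewrite inE /= in_itv /= => /andP[nt tn].
  congr (ereal_inf (image _ _)); apply/funext => s; apply/propext.
  split => -[s0 st]; split => //; last by apply: le_trans st _; rewrite lee_fin.
  have mS := measurable_gt_ecabs s%:E mf.
  have [E|[k E]] := measure_atomic_multiple b0 eP mS; rewrite E ?leye_eq // in st *.
  (* From [k beta <= t < (n+1) beta] follows [k <= n], so a level admissible at [t] is already
     admissible at [n beta]. *)
  move: st; rewrite !lee_fin => /le_lt_trans/(_ tn).
  by rewrite ltr_pM2r // ltr_nat ltnS ler_pM2r // ler_nat.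
rewrite integral_cst //= lebesgue_measure_itv /= lte_fin ltr_pM2r // ltr_nat leqnn.
rewrite -EFinB -mulrBl -natrB // subSnn mul1r muleCA -EFinM mulVf ?mule1 //.
exact: lt0r_neq0.
Qed.

Lemma distribution_transplant_rearr (D : representation_choice mu) f s :
  ecmeasurable f -> (0 <= s)%R ->
  mu [set x | s%:E < transplant D (toM (rearr mu f)) x] =
  mu [set x | s%:E < ecabs (f x)].
Proof.
move=> mf s0; have mS := measurable_gt_ecabs s%:E mf.
(* Ensures that restricting to [supp_itv mu], or to the existing atoms, cuts off no mass. *)
have muS : mu [set x | s%:E < ecabs (f x)] <= mu setT.
  by apply: le_measure; rewrite ?inE.
case: D => [sigma nA sP|beta e cA b0 eP].
  rewrite distribution_transplant_nonatomic // rearr_rearr //.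
  rewrite -[RHS]lebesgue_measure_ge0_lt //; congr (lebesgue_measure _).
  apply/seteqP; split => t /=; rewrite lt_rearr // => -[].
    by move=> [].
  by move=> t0 tS; split => //; split => //; exact: lt_le_trans muS.
rewrite distribution_transplant_atomic //.
under eq_set => n do rewrite (average_rearr_rearr n b0 eP) // lt_rearr //.
have [E|[k E]] := measure_atomic_multiple b0 eP mS; rewrite E.
  (* A level set of infinite measure forces [mu setT = +oo], so every [n] indexes an atom. *)
  rewrite (_ : _ `&` _ = setT).
    by rewrite /counting asboolF ?gt0_muley ?lte_fin //; exact: infinite_nat.
  apply/seteqP; split => n // _; split; last by rewrite /= ltry.
  by rewrite /atom_index /=; apply: le_trans muS; rewrite E leey.
(* For [n < k], [(n+1) beta <= k beta <= mu setT], so [n] is an index; exactly [k] atoms are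
   counted. *)
rewrite (_ : _ `&` _ = `I_k).
  by rewrite /counting asboolT ?(card_fset_set (n := k)) -?EFinM 1?mulrC.
apply/seteqP; split => n /=; rewrite lte_fin ltr_pM2r // ltr_nat; first by case.
move=> nk; split => //; apply: le_trans muS; rewrite E lee_fin.
by rewrite ler_pM2r // ler_nat.
Qed.

(** * Rearrangement invariance applied to canonical norms *)

Lemma ecmeasurable_transplant (D : representation_choice mu) g :
  ecmeasurable (toM (transplant D g)).
Proof. exact/ecmeasurable_toM/measurable_transplant. Qed.

Lemma canonical_norm_rearr N (D : representation_choice mu) f :
  ri_quasi_Banach_norm mu N -> ecmeasurable f ->
  canonical_norm D N (toM (rearr mu f)) = N f.
Proof.
move=> NP mf; apply: (riqb_rearr NP) => //; first exact: ecmeasurable_transplant.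
move=> t _; apply: eq_rearr => s s0; rewrite -(distribution_transplant_rearr D mf s0).
by congr (mu _); apply/seteqP; split => x /=; rewrite ecabs_of_ereal ?transplant_ge0.
Qed.

(** Allows the theorem to take three unrelated choices [DA], [DB] and [DAB]. *)
Lemma eq_canonical_norm N (D1 D2 : representation_choice mu) g :
  resonant mu -> ri_quasi_Banach_norm mu N ->
  canonical_norm D1 N g = canonical_norm D2 N g.
Proof.
move=> res NP; apply: (riqb_rearr NP); [exact: ecmeasurable_transplant..|].
move=> t _; apply: eq_rearr => s s0.
transitivity (mu [set x | s%:E < transplant D1 g x]).
  by congr (mu _); apply/seteqP; split => x /=; rewrite ecabs_of_ereal ?transplant_ge0.
rewrite (eq_distribution_transplant D1 D2) //.
by congr (mu _); apply/seteqP; split => x /=; rewrite ecabs_of_ereal ?transplant_ge0.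
Qed.

End transplant.

Theorem proposition2p3 (R : realType) (d : measure_display)
    (T : measurableType d) (mu : {measure set T -> \bar R})
    (mu_resonant : resonant mu)
    (A B : (T -> ecomplex R) -> \bar R)
    (A_riqb : ri_quasi_Banach_norm mu A) (B_riqb : ri_quasi_Banach_norm mu B)
    (DA DB DAB : representation_choice mu) :
  (forall f : T -> ecomplex R, ecmeasurable f ->
     capnorm A B f =
     capnorm (canonical_norm DA A) (canonical_norm DB B) (toM (rearr mu f)))
  /\
  (forall g : measurableTypeR R -> ecomplex R, ecmeasurable g ->
     capnorm (canonical_norm DA A) (canonical_norm DB B) g =
     canonical_norm DAB (capnorm A B) g).
Proof.
split => [f mf|g _]; rewrite /capnorm.
  by rewrite !canonical_norm_rearr.
(* On the right both norms see the same transplant, so the maximum splits by definition; only the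
   change of choice remains. *)
by congr maxe; exact: eq_canonical_norm.
Qed.
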